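(* Let $\mathbb F$ be a field and $\mathcal I$ an index set. For each $i\in\mathcal I$ let $n_i,m_i$ be positive integers. Let $\mathcal A=\{A_{ij}\}_{i,j\in\mathcal I}$ and $\mathcal B=\{B_{ij}\}_{i,j\in\mathcal I}$ be families of matrices over $\mathbb F$, where $A_{ij}$ is $n_i\times n_j$ and $B_{ij}$ is $m_i\times m_j$. For each $i\in\mathcal I$ let $X_i$ be an $n_i\times m_i$ matrix over $\mathbb F$, and suppose that $A_{ij}X_j=X_iB_{ij}$ for all $i,j\in\mathcal I$. 1. Suppose both $\mathcal A$ and $\mathcal B$ are irreducible in the coupled sense. Then either $X_i=0$ for all $i$, or $X_i$ is nonsingular for all $i$. In the latter case, $m_i=n_i$ for all $i$. If $\mathcal A=\mathcal B$ and $\mathcal A$ is a family of complex matrices ($\mathbb F=\mathbb C$), then there is a scalar $\alpha$ such that $X_i=\alpha I_{n_i}$ for all $i$. 2. Suppose neither $\mathcal A$ nor $\mathcal B$ is properly reducible in the coupled sense. Then for each $i$, either $X_i=0$ or $X_i$ is nonsingular. If $X_i$ is nonzero then $m_i=n_i$. If $\mathcal A=\mathcal B$ consists of complex matrices ($\mathbb F=\mathbb C$), then any nonzero $X_i$ is a scalar multiple of $I_{n_i}$.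
   Context: The index set $\mathcal I$ may be finite or infinite. Nonsingular means square and invertible. Let $\mathcal A=\{A_{ij}\}_{i,j\in\mathcal I}$ with $A_{ij}$ an $n_i\times n_j$ matrix over $\mathbb F$, and let $\mathcal V_i=\mathbb F^{n_i}$, so $A_{ij}$ is a linear map $\mathcal V_j\to\mathcal V_i$. The family $\mathcal A$ is reducible in the coupled sense if there exist subspaces $\mathcal U_i\subseteq\mathcal V_i$ ($i\in\mathcal I$) such that (1) $\mathcal U_i\neq\{0\}$ for at least one $i$; (2) $\mathcal U_i\neq\mathcal V_i$ for at least one $i$; (3) $A_{ij}(\mathcal U_j)\subseteq\mathcal U_i$ for all $i,j\in\mathcal I$. It is irreducible in the coupled sense if it is not reducible in the coupled sense. It is properly reducible in the coupled sense if such subspaces exist with, in addition, at least one $\mathcal U_i$ a nonzero proper subspace of $\mathcal V_i$. The same definitions apply to $\mathcal B$, with $\mathcal W_i=\mathbb F^{m_i}$ in place of $\mathcal V_i$. *)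

(* Defs.v *)
From HB Require Import structures.
From mathcomp Require Import all_boot all_order all_algebra.
From mathcomp Require Import reals.
From mathcomp Require Import complex.

Set Implicit Arguments.
Unset Strict Implicit.
Unset Printing Implicit Defensive.

Import GRing.Theory.

Local Open Scope ring_scope.

Definition matrix_family (F : fieldType) (I : Type) (n : I -> nat) : Type :=
  forall i j : I, 'M[F]_(n i, n j).

Definition subspace_family (F : fieldType) (I : Type) (n : I -> nat) : Type :=
  forall i : I, {vspace 'cV[F]_(n i)}.

Definition coupled_invariant (F : fieldType) (I : Type) (n : I -> nat)
    (A : matrix_family F n) (U : subspace_family F n) : Prop :=
  forall (i j : I) (u : 'cV[F]_(n j)), u \in U j -> A i j *m u \in U i.

Definition coupled_reducing (F : fieldType) (I : Type) (n : I -> nat)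
    (A : matrix_family F n) (U : subspace_family F n) : Prop :=
  [/\ exists i, U i != 0%VS,
      exists i, U i != fullv
    & coupled_invariant A U].

Definition coupled_reducible (F : fieldType) (I : Type) (n : I -> nat)
    (A : matrix_family F n) : Prop :=
  exists U : subspace_family F n, coupled_reducing A U.

Definition coupled_irreducible (F : fieldType) (I : Type) (n : I -> nat)
    (A : matrix_family F n) : Prop :=
  ~ coupled_reducible A.

Definition coupled_properly_reducible (F : fieldType) (I : Type)
    (n : I -> nat) (A : matrix_family F n) : Prop :=
  exists2 U : subspace_family F n, coupled_reducing A U &
    exists i, (U i != 0%VS) && (U i != fullv).

(* [unitmx] only makes sense at a type of the form ['M_n], hence the cast. *)
Definition nonsingular (F : fieldType) (n m : nat) (X : 'M[F]_(n, m)) : Prop :=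
  exists e : m = n, castmx (erefl n, e) X \in unitmx.

Definition intertwines (F : fieldType) (I : Type) (n m : I -> nat)
    (A : matrix_family F n) (B : matrix_family F m)
    (X : forall i : I, 'M[F]_(n i, m i)) : Prop :=
  forall i j : I, A i j *m X j = X i *m B i j.

(* Main.v *)
Require Import Defs.
From HB Require Import structures.
From mathcomp Require Import all_boot all_order all_algebra.
From mathcomp Require Import reals.
From mathcomp Require Import complex.
From Stdlib Require Import Classical.

Set Implicit Arguments.
Unset Strict Implicit.
Unset Printing Implicit Defensive.

Import GRing.Theory.

Local Open Scope ring_scope.

(** This is Schur's lemma for coupled families.  The relations
    [A i j *m X j = X i *m B i j] make the images of the [X i] an [A]-invariant
    family of subspaces and their kernels a [B]-invariant one
    ([coupled_invariant_limg], [coupled_invariant_lker]).  Irreducibility lets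
    an invariant family be only zero everywhere or full everywhere; absence of
    proper reductions lets each single member be only zero or full.  Hence a
    nonzero [X i] is onto and one-to-one, so square and invertible; under
    irreducibility one nonzero [X i] forces this at every index.

    For the scalar statements, [X i - a%:M] intertwines [A] with itself for
    every scalar [a].  Over an algebraically closed field, [a] can be chosen as
    an eigenvalue of one [X i0], which exists because [n i0] is positive.  Then
    [X i0 - a%:M] is singular, so the first part makes it vanish, together with
    all the other [X i - a%:M] in the irreducible case. *)

(** * Nonsingular matrices *)

(** The image and kernel of the linear map [u |-> X *m u] are taken as those of
    this element of ['Hom], which makes them values of type [{vspace _}]. *)
Definition mulmx_hom (F : fieldType) (n m : nat) (X : 'M[F]_(n, m)) :
  'Hom('cV[F]_m, 'cV[F]_n) := linfun (mulmx X).

Lemma mulmx_homE (F : fieldType) (n m : nat) (X : 'M[F]_(n, m)) u :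
  mulmx_hom X u = X *m u.
Proof. by rewrite lfunE. Qed.

Lemma mulmx_col_eq0 (F : fieldType) (n m : nat) (X : 'M[F]_(n, m)) :
  (forall u : 'cV[F]_m, X *m u = 0) -> X = 0.
Proof.
move=> X0; apply/matrixP=> i j; have /matrixP/(_ i 0) := X0 (delta_mx j 0).
by rewrite -colE !mxE.
Qed.

Lemma limg_mulmx_hom_neq0 (F : fieldType) (n m : nat) (X : 'M[F]_(n, m)) :
  X <> 0 -> limg (mulmx_hom X) != 0%VS.
Proof.
move=> Xn0; apply/eqP=> img0; apply/Xn0/mulmx_col_eq0=> u.
by apply/eqP; rewrite -memv0 -img0 -mulmx_homE memv_img ?memvf.
Qed.

Lemma lker_mulmx_hom_neq_full (F : fieldType) (n m : nat) (X : 'M[F]_(n, m)) :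
  X <> 0 -> lker (mulmx_hom X) != fullv.
Proof.
move=> Xn0; apply/eqP=> kerf; apply/Xn0/mulmx_col_eq0=> u.
by apply/eqP; rewrite -mulmx_homE -memv_ker kerf memvf.
Qed.

(** Rank-nullity gives [m = n]; a square matrix with trivial kernel has a
    nonzero determinant. *)
Lemma nonsingular_bij (F : fieldType) (n m : nat) (X : 'M[F]_(n, m)) :
  limg (mulmx_hom X) = fullv -> lker (mulmx_hom X) = 0%VS -> nonsingular X.
Proof.
move=> imgf ker0.
have e : m = n.
  have := limg_ker_dim (mulmx_hom X) fullv.
  by rewrite imgf ker0 capv0 dimv0 !dimvf /dim /= !muln1.
case: n / e X imgf ker0 => X _ ker0; exists erefl; rewrite castmx_id.
rewrite -unitmx_tr unitmxE unitfE; apply/det0P=> -[v v_n0 vX0].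
case/negP: v_n0; rewrite -[v]trmxK -trmx0 (inj_eq trmx_inj) -memv0 -ker0.
by rewrite memv_ker mulmx_homE -[X]trmxK -trmx_mul vX0 trmx0.
Qed.

Lemma nonsingular_square (F : fieldType) (n : nat) (X : 'M[F]_n) :
  nonsingular X -> X \in unitmx.
Proof. by case=> e; rewrite castmx_id. Qed.

Lemma singular_sub_eigenvalue (F : fieldType) (n : nat) (X : 'M[F]_n) (a : F) :
  eigenvalue X a -> ~ nonsingular (X - a%:M).
Proof.
case/eigenvalueP=> v vX v_n0 /nonsingular_square.
rewrite unitmxE unitfE; apply/negP; rewrite negbK; apply/det0P.
by exists v; rewrite // mulmxBr vX mul_mx_scalar subrr.
Qed.

Lemma exists_eigenvalue (F : closedFieldType) (n : nat) (X : 'M[F]_n) :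
  (0 < n)%N -> exists a, eigenvalue X a.
Proof.
move=> n_gt0; have /closed_rootP[a ra] : size (char_poly X) != 1.
  by rewrite size_char_poly eqSS -lt0n.
by exists a; rewrite eigenvalue_root_char.
Qed.

(** * Invariant families *)

Lemma coupled_invariant_limg (F : fieldType) (I : Type) (n m : I -> nat)
    (A : matrix_family F n) (B : matrix_family F m)
    (X : forall i : I, 'M[F]_(n i, m i)) :
  intertwines A B X ->
  coupled_invariant A (fun i => limg (mulmx_hom (X i))).
Proof.
move=> AXB i j _ /memv_imgP[w _ ->].
by rewrite mulmx_homE mulmxA AXB -mulmxA -mulmx_homE memv_img ?memvf.
Qed.

Lemma coupled_invariant_lker (F : fieldType) (I : Type) (n m : I -> nat)
    (A : matrix_family F n) (B : matrix_family F m)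
    (X : forall i : I, 'M[F]_(n i, m i)) :
  intertwines A B X ->
  coupled_invariant B (fun i => lker (mulmx_hom (X i))).
Proof.
move=> AXB i j w; rewrite !memv_ker !mulmx_homE mulmxA -AXB -mulmxA => /eqP->.
by rewrite mulmx0.
Qed.

Lemma coupled_irreducible_full (F : fieldType) (I : Type) (n : I -> nat)
    (A : matrix_family F n) (U : subspace_family F n) (i j : I) :
  coupled_irreducible A -> coupled_invariant A U ->
  U i != 0%VS -> U j = fullv.
Proof.
move=> irrA invU Ui; apply/eqP/negPn/negP=> Uj.
by apply: irrA; exists U; split=> //; [exists i | exists j].
Qed.

Lemma not_properly_reducible_full (F : fieldType) (I : Type) (n : I -> nat)
    (A : matrix_family F n) (U : subspace_family F n) (i : I) :
  ~ coupled_properly_reducible A -> coupled_invariant A U ->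
  U i != 0%VS -> U i = fullv.
Proof.
move=> nprA invU Ui; apply/eqP/negPn/negP=> Uif; apply: nprA.
by exists U; [split=> //; exists i | exists i; rewrite Ui].
Qed.

(** * Schur's lemma *)

Lemma schur_irreducible (F : fieldType) (I : Type) (n m : I -> nat)
    (A : matrix_family F n) (B : matrix_family F m)
    (X : forall i : I, 'M[F]_(n i, m i)) :
  intertwines A B X -> coupled_irreducible A -> coupled_irreducible B ->
  (forall i, X i = 0) \/ (forall i, nonsingular (X i)).
Proof.
move=> AXB irrA irrB.
have [X0 | /not_all_ex_not[i0 Xi0]] := classic (forall i, X i = 0).
  by left.
right=> i; apply: nonsingular_bij.
  have imgi0 := limg_mulmx_hom_neq0 Xi0.
  exact: (coupled_irreducible_full i irrA (coupled_invariant_limg AXB) imgi0).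
(* A nonzero kernel anywhere would make the kernel at [i0] full. *)
apply/eqP/negPn/negP=> keri; case/eqP: (lker_mulmx_hom_neq_full Xi0).
exact: (coupled_irreducible_full i0 irrB (coupled_invariant_lker AXB) keri).
Qed.

Lemma schur_not_properly_reducible (F : fieldType) (I : Type)
    (n m : I -> nat) (A : matrix_family F n) (B : matrix_family F m)
    (X : forall i : I, 'M[F]_(n i, m i)) (i : I) :
  intertwines A B X ->
  ~ coupled_properly_reducible A -> ~ coupled_properly_reducible B ->
  X i = 0 \/ nonsingular (X i).
Proof.
move=> AXB nprA nprB; have [-> | /eqP Xi] := eqVneq (X i) 0; first by left.
right; apply: nonsingular_bij.
  have imgi := limg_mulmx_hom_neq0 Xi.
  exact: (not_properly_reducible_full nprA (coupled_invariant_limg AXB) imgi).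
apply/eqP/negPn/negP=> keri; case/eqP: (lker_mulmx_hom_neq_full Xi).
exact: (not_properly_reducible_full nprB (coupled_invariant_lker AXB) keri).
Qed.

Lemma intertwines_sub_scalar (F : fieldType) (I : Type) (n : I -> nat)
    (A : matrix_family F n) (X : forall i : I, 'M[F]_(n i)) (a : F) :
  intertwines A A X -> intertwines A A (fun i => X i - a%:M).
Proof.
by move=> AXA i j; rewrite mulmxBr mulmxBl AXA mul_mx_scalar mul_scalar_mx.
Qed.

Lemma schur_irreducible_scalar (F : closedFieldType) (I : Type)
    (n : I -> nat) (A : matrix_family F n) (X : forall i : I, 'M[F]_(n i)) :
  (forall i, (0 < n i)%N) -> intertwines A A X -> coupled_irreducible A ->
  exists a : F, forall i, X i = a%:M.
Proof.
move=> n_gt0 AXA irrA.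
(* Over an empty index set every scalar works. *)
have [[i0 _] | noI] := classic (exists i : I, True); last first.
  by exists 0 => i; case: noI; exists i.
have [a eig_a] := exists_eigenvalue (X i0) (n_gt0 i0).
exists a => i; apply/eqP; rewrite -subr_eq0; apply/eqP.
have AXaA := intertwines_sub_scalar a AXA.
have [-> // | /(_ i0) nsX] := schur_irreducible AXaA irrA irrA.
by case: (singular_sub_eigenvalue eig_a).
Qed.

Lemma schur_not_properly_reducible_scalar (F : closedFieldType) (I : Type)
    (n : I -> nat) (A : matrix_family F n) (X : forall i : I, 'M[F]_(n i))
    (i : I) :
  (0 < n i)%N -> intertwines A A X -> ~ coupled_properly_reducible A ->
  exists a : F, X i = a%:M.
Proof.
move=> n_gt0 AXA nprA; have [a eig_a] := exists_eigenvalue (X i) n_gt0.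
exists a; apply/eqP; rewrite -subr_eq0; apply/eqP.
have AXaA := intertwines_sub_scalar a AXA.
have [// | nsX] := schur_not_properly_reducible i AXaA nprA nprA.
by case: (singular_sub_eigenvalue eig_a).
Qed.

Theorem theorem4p2 (I : Type) (n m : I -> nat)
    (n_gt0 : forall i : I, (0 < n i)%N) (m_gt0 : forall i : I, (0 < m i)%N) :
  ((forall (F : fieldType) (A : matrix_family F n) (B : matrix_family F m)
      (X : forall i : I, 'M[F]_(n i, m i)),
      intertwines A B X ->
      coupled_irreducible A -> coupled_irreducible B ->
      (forall i : I, X i = 0)
      \/ ((forall i : I, nonsingular (X i)) /\ (forall i : I, m i = n i)))
   /\
   (forall (R : realType) (A : matrix_family (complex R) n)
      (X : forall i : I, 'M[complex R]_(n i)),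
      intertwines A A X ->
      coupled_irreducible A ->
      exists alpha : complex R, forall i : I, X i = alpha%:M))
  /\
  ((forall (F : fieldType) (A : matrix_family F n) (B : matrix_family F m)
      (X : forall i : I, 'M[F]_(n i, m i)),
      intertwines A B X ->
      ~ coupled_properly_reducible A -> ~ coupled_properly_reducible B ->
      forall i : I,
        (X i = 0 \/ nonsingular (X i)) /\ (X i <> 0 -> m i = n i))
   /\
   (forall (R : realType) (A : matrix_family (complex R) n)
      (X : forall i : I, 'M[complex R]_(n i)),
      intertwines A A X ->
      ~ coupled_properly_reducible A ->
      forall i : I, X i <> 0 ->
        exists alpha : complex R, X i = alpha%:M)).
Proof.
split; split.
- move=> F A B X AXB irrA irrB.
  have [X0 | nsX] := schur_irreducible AXB irrA irrB; [by left | right].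
  by split=> // i; have [e _] := nsX i.
- by move=> R A X; apply: schur_irreducible_scalar.
- move=> F A B X AXB nprA nprB i.
  have dich := schur_not_properly_reducible i AXB nprA nprB.
  by split=> // Xi; case: dich => [// | [e _]].
- by move=> R A X AXA nprA i _; apply: schur_not_properly_reducible_scalar AXA _.
Qed.
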